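(* Let $n\in\mathbb{N}$, let $\alpha_i>0$ and $x_i>0$ ($i=1,\ldots,n$) be real numbers with $\sum_{i=1}^n\alpha_i=1$, and suppose that the $x_i$ are not all equal. Let $$h=\Big(\sum_{i=1}^n\frac{\alpha_i}{x_i}\Big)^{-1},\qquad g=\prod_{i=1}^n x_i^{\alpha_i},\qquad a=\sum_{i=1}^n\alpha_i x_i,\qquad \alpha=\min_i\{\alpha_i\}.$$ Let $\xi_0\in[0,1]$ and $\xi_1\in[1,1/\alpha]$ be the (unique) solutions in these respective intervals of the equation $$h=a\,\frac{\xi(1-\alpha\xi)}{\alpha-2\alpha\xi+\xi}.$$ Then $$a\,\xi_1^{\alpha}\left(\frac{1-\alpha\xi_1}{1-\alpha}\right)^{1-\alpha}\;\le\; g\;\le\; a\,\xi_0^{\alpha}\left(\frac{1-\alpha\xi_0}{1-\alpha}\right)^{1-\alpha}.$$ Moreover, the first (resp. second) inequality is an equality if and only if there is an index $j$ with $\alpha_j=\min_i\{\alpha_i\}$ such that $x_j=a\,\xi_1$ (resp. $x_j=a\,\xi_0$) and $x_l=x_k$ for all $l,k\neq j$.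
   Context: The quantities $h$, $g$, $a$ are the weighted harmonic, geometric and arithmetic means of the $x_i$ with weights $\alpha_i$. Since the $x_i$ are not all equal, $n\ge 2$ and hence $0<\alpha\le 1/2$. *)

(* Defs.v *)
From HB Require Import structures.
From mathcomp Require Import all_boot all_order all_algebra.
From mathcomp Require Import all_classical all_reals all_analysis.

Set Implicit Arguments.
Unset Strict Implicit.
Unset Printing Implicit Defensive.

Import Order.TTheory GRing.Theory Num.Theory.
Local Open Scope ring_scope.

Definition weighted_harmonic_mean (R : realType) (n : nat) (w x : 'I_n -> R) : R :=
  (\sum_(i < n) w i / x i)^-1.

Definition weighted_geometric_mean (R : realType) (n : nat) (w x : 'I_n -> R) : R :=
  \prod_(i < n) x i `^ w i.

Definition weighted_arithmetic_mean (R : realType) (n : nat) (w x : 'I_n -> R) : R :=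
  \sum_(i < n) w i * x i.

(* The initial value 1 never matters for positive weights of total mass 1:
   then n > 0 and every w i is at most 1, so this is the least w i. *)
Definition min_weight (R : realType) (n : nat) (w : 'I_n -> R) : R :=
  \big[Num.min/1]_(i < n) w i.

(* If a single value a * xi has weight m and all the other values are equal,
   the total weight being 1 and the arithmetic mean a, then the other values
   are a * (1 - m * xi) / (1 - m), and the harmonic and geometric means are the
   next two expressions. *)
Definition two_value_harmonic (R : realType) (a m xi : R) : R :=
  a * (xi * (1 - m * xi) / (m - 2 * m * xi + xi)).

Definition two_value_geometric (R : realType) (a m xi : R) : R :=
  a * xi `^ m * ((1 - m * xi) / (1 - m)) `^ (1 - m).

(* Main.v *)
Require Import Defs.
From HB Require Import structures.
From mathcomp Require Import all_boot all_order all_algebra.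
From mathcomp Require Import all_classical all_reals all_analysis.
From mathcomp Require Import ring lra.

Set Implicit Arguments.
Unset Strict Implicit.
Unset Printing Implicit Defensive.

Import Order.TTheory GRing.Theory Num.Theory.
Local Open Scope ring_scope.

(** Why the theorem is true.

    Call u = a * xi and v = a * (1 - m * xi) / (1 - m), with m the least
    weight.  The equation for xi says exactly that the law putting mass m at u
    and mass 1 - m at v has the same mean a and the same mean reciprocal 1 / h
    as the given data, and [two_value_geometric] is the geometric mean of this
    law.  So the theorem compares the mean of ln x_i with that of ln under a
    two-point law sharing the averages of 1, x and 1 / x, hence the average of
    every function A + B * x + C / x.

    For xi = xi0 one has u < v.  Choose A, B, C so that the graph of
    A + B * x + C / x meets that of ln at u and is tangent to it at v.  Then
    ln x <= A + B * x + C / x on [u, +oo), with equality only at u and v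
    ([ln_two_point_majorant]).  The inequality fails near 0, but this does no
    harm, because no x_j lies below u: the function (x - v)^2 / x is
    nonnegative, has average m * (u - v)^2 / u, and decreases on (0, v], so an
    x_j < u, whose weight is at least m, would already exceed that average
    ([two_point_le_value]).  Averaging the majorant gives the upper bound on g.
    Equality forces every x_i into {u, v}, and the mean then leaves room for
    just one index, of weight m, at u ([two_valued_rigid]).

    The lower bound is the upper bound for the data 1 / x_i: inversion swaps
    the roles of a and 1 / h, negates ln, and turns the order u > v that holds
    for xi = xi1 into 1 / u < 1 / v.

    Finally xi0 and xi1 are the roots of a quadratic which is nonnegative at 0
    and 1 / m and negative at 1, because h < a. *)

(** * A majorant of the logarithm touching it at two points *)

Lemma is_derive_ln_affine_inv (R : realType) (B C s : R) : 0 < s ->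
  is_derive s 1 (fun x : R => ln x - B * x - C * x^-1) (s^-1 - B + C * s ^- 2).
Proof.
move=> s_gt0; have s_neq0 : s != 0 by rewrite gt_eqF.
have dln := is_derive1_ln s_gt0.
have dV := is_deriveV s_neq0 (is_derive_id s 1).
apply: is_derive_eq; rewrite /GRing.scale /=; ring.
Qed.

Lemma MVT_ln_affine_inv (R : realType) (B C y z : R) :
  let f x := ln x - B * x - C * x^-1 in
  0 < y -> y < z ->
  exists2 s, y < s < z & f z - f y = (s^-1 - B + C * s ^- 2) * (z - y).
Proof.
move=> f y_gt0 yz.
have df s : y <= s -> is_derive s 1 f (s^-1 - B + C * s ^- 2).
  by move=> ys; apply: is_derive_ln_affine_inv; apply: lt_le_trans ys.
have dfi s : s \in `]y, z[ -> is_derive s 1 f (s^-1 - B + C * s ^- 2).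
  by rewrite in_itv/= => /andP[/ltW/df].
have [|s] := MVT yz dfi.
  apply: derivable_within_continuous => s; rewrite in_itv/= => /andP[ys _].
  by have [] := df s ys.
by rewrite in_itv/= => syz eqf; exists s.
Qed.

(** The constants make f x = ln x - B * x - C / x take the same value at u
    and v and be stationary at v.  By Rolle, f' has a further zero d in (u, v);
    since x^2 f'(x) is quadratic, it equals B * (x - v) * (d - x), with B > 0.
    Hence f decreases on (u, d), increases on (d, v) and decreases after v, so
    that to the right of u it stays below f u = f v except at v. *)
Lemma ln_two_point_majorant (R : realType) (u v : R) : 0 < u -> u < v ->
  exists A B C : R,
    [/\ ln u = A + B * u + C / u, ln v = A + B * v + C / v &
        forall x, u < x -> x != v -> ln x < A + B * x + C / x].
Proof.
move=> u_gt0 uv; have v_gt0 := lt_trans u_gt0 uv.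
have u_neq0 : u != 0 by rewrite gt_eqF.
have v_neq0 : v != 0 by rewrite gt_eqF.
have uv_neq0 : u - v != 0 by rewrite subr_eq0 lt_eqF.
(* C solves f u = f v once B is fixed by f' v = 0. *)
pose C := (ln u - ln v - (u - v) / v) * (u * v ^+ 2) / (u - v) ^+ 2.
pose B := v^-1 + C / v ^+ 2.
pose f x := ln x - B * x - C * x^-1.
have fE x : ln x = f x + B * x + C / x by rewrite /f; ring.
have fuv : f u = f v.
  rewrite /f /B /C; field; by rewrite u_neq0 v_neq0 uv_neq0.
pose df s := s^-1 - B + C * s ^- 2.
have mvt y z : 0 < y -> y < z ->
    exists2 s, y < s < z & f z - f y = df s * (z - y).
  exact: MVT_ln_affine_inv.
have dfE s : 0 < s -> s ^+ 2 * df s = (s - v) * (1 - B * (s + v)).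
  move=> s_gt0; have CE : C = B * v ^+ 2 - v by rewrite /B; field.
  by rewrite /df CE; field; rewrite gt_eqF.
have [d /andP[ud dv]] := mvt u v u_gt0 uv.
have d_gt0 := lt_trans u_gt0 ud.
rewrite fuv subrr => /esym/eqP; rewrite mulf_eq0 [v - u == 0]subr_eq0.
rewrite (gt_eqF uv) orbF => /eqP df0.
have Bd : B * (d + v) = 1.
  have := dfE d d_gt0; rewrite df0 mulr0 => /esym/eqP.
  by rewrite mulf_eq0 !subr_eq0 (lt_eqF dv)/= => /eqP.
have B_gt0 : 0 < B by rewrite -(pmulr_lgt0 _ (addr_gt0 d_gt0 v_gt0)) Bd.
have {}dfE s : 0 < s -> s ^+ 2 * df s = B * ((s - v) * (d - s)).
  by move=> /dfE->; rewrite -Bd; ring.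
(* On (0, v) the derivative is negative before d and positive after it. *)
have df_ge0 s : 0 < s -> s < v -> 0 <= df s -> d <= s.
  move=> s_gt0 sv h; rewrite leNgt; apply/negP => sd.
  have := mulr_ge0 (sqr_ge0 s) h; rewrite dfE// pmulr_rge0//.
  by rewrite nmulr_rge0 ?subr_lt0// subr_le0 leNgt sd.
have df_le0 s : 0 < s -> s < v -> df s <= 0 -> s <= d.
  move=> s_gt0 sv h; rewrite leNgt; apply/negP => sd.
  have := mulr_ge0_le0 (sqr_ge0 s) h; rewrite dfE// pmulr_rle0//.
  by rewrite nmulr_rle0 ?subr_lt0// subr_ge0 leNgt sd.
exists (f v), B, C; split; [by rewrite -fuv -fE | exact: fE |].
move=> x ux xv; rewrite [ltLHS]fE !ltrD2r ltNge; apply/negP => fvx.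
have x_gt0 := lt_trans u_gt0 ux.
have [{}xv|vx|/eqP] := ltgtP x v; last by rewrite (negbTE xv).
(* If f x >= f u = f v with u < x < v, then f' is nonnegative somewhere
     before x and nonpositive somewhere after x, against its sign pattern. *)
- have [s1 /andP[us1 s1x] e1] := mvt u x u_gt0 ux.
  have [s2 /andP[xs2 s2v] e2] := mvt x v x_gt0 xv.
  have : d <= s1.
    apply: df_ge0; [exact: lt_trans us1|exact: lt_trans xv|].
    by rewrite -(@pmulr_lge0 _ (x - u)) ?subr_gt0// -e1 subr_ge0 fuv.
  have : s2 <= d.
    apply: df_le0 => //; first exact: lt_trans xs2.
    by rewrite -(@pmulr_lle0 _ (v - x)) ?subr_gt0// -e2 subr_le0.
  by move: s1x xs2; lra.
- have [s /andP[vs sx] e] := mvt v x v_gt0 vx.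
  have s_gt0 := lt_trans v_gt0 vs.
  have : 0 <= df s.
    by rewrite -(@pmulr_lge0 _ (x - v)) ?subr_gt0// -e subr_ge0.
  move/(mulr_ge0 (sqr_ge0 s)); rewrite dfE// pmulr_rge0// pmulr_rge0 ?subr_gt0//.
  by move: dv vs; lra.
Qed.

(** * Averages that agree with those of a two-point law *)

Lemma sum_affine_inv (R : realType) (n : nat) (w x : 'I_n -> R) (A B C : R) :
  \sum_(i < n) w i = 1 ->
  \sum_(i < n) w i * (A + B * x i + C / x i) =
    A + B * (\sum_(i < n) w i * x i) + C * (\sum_(i < n) w i / x i).
Proof.
move=> w1; under eq_bigr => i _.
  have -> : w i * (A + B * x i + C / x i) =
    A * w i + B * (w i * x i) + C * (w i / x i) by ring.
  over.
by rewrite !big_split/= -!mulr_sumr w1 mulr1.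
Qed.

Lemma two_point_sum (R : realType) (n : nat) (w x : 'I_n -> R) (m u v : R) :
  \sum_(i < n) w i = 1 ->
  \sum_(i < n) w i * x i = m * u + (1 - m) * v ->
  \sum_(i < n) w i / x i = m / u + (1 - m) / v ->
  forall A B C : R, \sum_(i < n) w i * (A + B * x i + C / x i) =
    m * (A + B * u + C / u) + (1 - m) * (A + B * v + C / v).
Proof. by move=> w1 wx wVx A B C; rewrite sum_affine_inv// wx wVx; ring. Qed.

(** This is Chebyshev's inequality for (x - v)^2 / x, a function that vanishes
    at v: its average is the contribution of u to the two-point law. *)
Lemma two_point_le_value (R : realType) (n : nat) (w x : 'I_n -> R)
    (m u v : R) :
  0 < m -> (forall i, m <= w i) -> (forall i, 0 < x i) -> 0 < u -> u < v ->
  \sum_(i < n) w i = 1 ->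
  \sum_(i < n) w i * x i = m * u + (1 - m) * v ->
  \sum_(i < n) w i / x i = m / u + (1 - m) / v ->
  forall j, u <= x j.
Proof.
move=> m_gt0 m_le x_gt0 u_gt0 uv w1 wx wVx j.
have v_gt0 := lt_trans u_gt0 uv.
(* (y - v)^2 / y, expanded so that its average can be computed. *)
pose k y := - 2 * v + 1 * y + v ^+ 2 / y.
have kE y : 0 < y -> k y = (y - v) ^+ 2 / y.
  by move=> y_gt0; rewrite /k; field; rewrite gt_eqF.
have k_ge0 y : 0 < y -> 0 <= k y.
  by move=> y_gt0; rewrite kE// divr_ge0 ?sqr_ge0 ?ltW.
have : \sum_(i < n) w i * k (x i) = m * k u.
  rewrite (two_point_sum w1 wx wVx) -/(k u) -/(k v) [k v]kE// subrr.
  by rewrite expr0n/= mul0r mulr0 addr0.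
have w_gt0 i : 0 < w i by apply: lt_le_trans (m_le i).
have wk_ge0 i : 0 <= w i * k (x i) by rewrite mulr_ge0 ?k_ge0 ?ltW.
rewrite (bigD1 j)//= => sumE; rewrite leNgt; apply/negP => xu.
have : k (x j) <= k u.
  rewrite -(ler_pM2l m_gt0) -sumE.
  apply: (@le_trans _ _ (w j * k (x j))); first by rewrite ler_wpM2r ?k_ge0.
  by rewrite lerDl sumr_ge0.
apply/negP; rewrite -ltNge -subr_gt0.
have -> : k (x j) - k u = (u - x j) * (v ^+ 2 - x j * u) / (x j * u).
  by rewrite /k; field; rewrite !gt_eqF.
have xuv : x j * u < v ^+ 2.
  by rewrite expr2 ltr_pM ?ltW// (lt_trans xu).
by rewrite divr_gt0 ?mulr_gt0 ?subr_gt0.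
Qed.

(** The average of v - x_i is m * (v - u), and each index with x_i = u
    contributes at least that much to it. *)
Lemma two_valued_rigid (R : realType) (n : nat) (w x : 'I_n -> R) (m u v : R) :
  0 < m -> (forall i, m <= w i) -> u < v -> \sum_(i < n) w i = 1 ->
  \sum_(i < n) w i * x i = m * u + (1 - m) * v ->
  (forall i, x i = u \/ x i = v) ->
  exists j, [/\ w j = m, x j = u & forall l, l != j -> x l = v].
Proof.
move=> m_gt0 m_le uv w1 wx xuv.
have w_gt0 i : 0 < w i by apply: lt_le_trans (m_le i).
have vu_gt0 : 0 < v - u by rewrite subr_gt0.
have sumE : \sum_(i < n) w i * (v - x i) = m * (v - u).
  under eq_bigr do rewrite mulrBr.
  by rewrite sumrB -mulr_suml w1 wx; ring.
have vx_ge0 i : 0 <= w i * (v - x i).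
  by apply: mulr_ge0; [exact: ltW | case: (xuv i) => ->; lra].
have [j xj] : exists j, x j = u.
  apply: contrapT => /forallNP xNu.
  have : m * (v - u) = 0.
    rewrite -sumE big1// => i _; case: (xuv i) => [/xNu//|->].
    by rewrite subrr mulr0.
  by apply/eqP; rewrite mulf_neq0 ?gt_eqF.
move: sumE; rewrite (bigD1 j)//= xj => sumE.
have rest_ge0 : 0 <= \sum_(i < n | i != j) w i * (v - x i) by rewrite sumr_ge0.
have wm : m * (v - u) <= w j * (v - u) by rewrite ler_wpM2r// ltW.
have rest0 : \sum_(i < n | i != j) w i * (v - x i) = 0 by lra.
exists j; split=> // [|l lj].
  by apply: (mulIf (lt0r_neq0 vu_gt0)); rewrite -sumE rest0 addr0.
have /(_ l lj)/eqP := psumr_eq0P (fun i (_ : i != j) => vx_ge0 i) rest0.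
by rewrite mulf_eq0 gt_eqF//= subr_eq0 => /eqP.
Qed.

Lemma two_valued_others (R : realType) (n : nat) (w x : 'I_n -> R)
    (m u v : R) (j : 'I_n) :
  (forall i, 0 < w i) -> \sum_(i < n) w i = 1 ->
  \sum_(i < n) w i * x i = m * u + (1 - m) * v ->
  w j = m -> x j = u -> (forall l k, l <> j -> k <> j -> x l = x k) ->
  forall l, l != j -> x l = v.
Proof.
move=> w_gt0 w1 wx wj xj xeq l lj.
have w1m : \sum_(i < n | i != j) w i = 1 - m.
  by rewrite -w1 [in RHS](bigD1 j)//= wj addrAC subrr add0r.
have m1 : 0 < 1 - m.
  rewrite -w1m (bigD1 l)//=; apply: ltr_wpDr (w_gt0 l).
  by apply: sumr_ge0 => i _; exact: ltW.
apply: (mulfI (lt0r_neq0 m1)).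
move: wx; rewrite (bigD1 j)//= wj xj => /addrI <-.
rewrite -w1m mulr_suml; apply: eq_bigr => i ij.
by congr (_ * _); apply: xeq; exact/eqP.
Qed.

(** The difference of the two sides is the average of the gap between the
    majorant of [ln_two_point_majorant] and ln, because the majorant has the
    same average for both laws. *)
Lemma weighted_ln_le_two_point (R : realType) (n : nat) (w x : 'I_n -> R)
    (m u v : R) :
  0 < m -> (forall i, m <= w i) -> (forall i, 0 < x i) -> 0 < u -> u < v ->
  \sum_(i < n) w i = 1 ->
  \sum_(i < n) w i * x i = m * u + (1 - m) * v ->
  \sum_(i < n) w i / x i = m / u + (1 - m) / v ->
  \sum_(i < n) w i * ln (x i) <= m * ln u + (1 - m) * ln v /\
  (\sum_(i < n) w i * ln (x i) = m * ln u + (1 - m) * ln v <->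
   exists j, w j = m /\ x j = u /\
     forall l k, l <> j -> k <> j -> x l = x k).
Proof.
move=> m_gt0 m_le x_gt0 u_gt0 uv w1 wx wVx.
have w_gt0 i : 0 < w i by apply: lt_le_trans (m_le i).
have ux := two_point_le_value m_gt0 m_le x_gt0 u_gt0 uv w1 wx wVx.
have [A [B [C [lnu lnv lnlt]]]] := ln_two_point_majorant u_gt0 uv.
have gap_ge0 i : 0 <= w i * (A + B * x i + C / x i - ln (x i)).
  rewrite mulr_ge0 ?(ltW (w_gt0 i))// subr_ge0.
  have := ux i; rewrite le_eqVlt => /predU1P[<-|uxi]; first by rewrite lnu.
  by have [->|/(lnlt _ uxi)/ltW//] := eqVneq (x i) v; rewrite lnv.
have gapE : \sum_(i < n) w i * (A + B * x i + C / x i - ln (x i)) =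
    m * ln u + (1 - m) * ln v - \sum_(i < n) w i * ln (x i).
  under eq_bigr do rewrite mulrBr.
  by rewrite sumrB (two_point_sum w1 wx wVx) -lnu -lnv.
split; first by rewrite -subr_ge0 -gapE sumr_ge0.
split=> [lnE|[j [wj [xj xeq]]]].
- have gap0 : \sum_(i < n) w i * (A + B * x i + C / x i - ln (x i)) = 0.
    by rewrite gapE lnE subrr.
  have xuv i : x i = u \/ x i = v.
    have /(_ i isT)/eqP :=
      psumr_eq0P (fun i (_ : true) => gap_ge0 i) gap0.
    rewrite mulf_eq0 gt_eqF//= subr_eq0 => /eqP lnxi.
    have := ux i; rewrite le_eqVlt => /predU1P[->|uxi]; first by left.
    have [->|/(lnlt _ uxi)] := eqVneq (x i) v; first by right.
    by rewrite lnxi ltxx.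
  have [j [wj xj xv]] := two_valued_rigid m_gt0 m_le uv w1 wx xuv.
  by exists j; do 2!split=> //; move=> l k /eqP lj /eqP kj; rewrite !xv.
- have xv := two_valued_others w_gt0 w1 wx wj xj xeq.
  have w1m : \sum_(i < n | i != j) w i = 1 - m.
    by rewrite -w1 [in RHS](bigD1 j)//= wj addrAC subrr add0r.
  rewrite (bigD1 j)//= wj xj -w1m mulr_suml; congr (_ + _).
  by apply: eq_bigr => i /xv ->.
Qed.

(** This is [weighted_ln_le_two_point] for the inverses of the x_i, which
    exchange the two moment conditions. *)
Lemma weighted_ln_ge_two_point (R : realType) (n : nat) (w x : 'I_n -> R)
    (m u v : R) :
  0 < m -> (forall i, m <= w i) -> (forall i, 0 < x i) -> 0 < v -> v < u ->
  \sum_(i < n) w i = 1 ->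
  \sum_(i < n) w i * x i = m * u + (1 - m) * v ->
  \sum_(i < n) w i / x i = m / u + (1 - m) / v ->
  m * ln u + (1 - m) * ln v <= \sum_(i < n) w i * ln (x i) /\
  (m * ln u + (1 - m) * ln v = \sum_(i < n) w i * ln (x i) <->
   exists j, w j = m /\ x j = u /\
     forall l k, l <> j -> k <> j -> x l = x k).
Proof.
move=> m_gt0 m_le x_gt0 v_gt0 vu w1 wx wVx.
have u_gt0 := lt_trans v_gt0 vu.
have sumN : \sum_(i < n) w i * ln (x i)^-1 = - \sum_(i < n) w i * ln (x i).
  by rewrite -sumrN; apply: eq_bigr => i _; rewrite lnV ?posrE// mulrN.
have rhsN : m * ln u^-1 + (1 - m) * ln v^-1 = - (m * ln u + (1 - m) * ln v).
  by rewrite !lnV ?posrE// !mulrN -opprD.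
have [] := @weighted_ln_le_two_point R n w (fun i => (x i)^-1) m u^-1 v^-1.
- by [].
- by [].
- by move=> i; rewrite invr_gt0.
- by rewrite invr_gt0.
- by rewrite ltf_pV2 ?posrE.
- by [].
- by [].
- by under eq_bigr do rewrite invrK; rewrite !invrK.
rewrite sumN rhsN lerN2 => le [eq1 eq2]; split=> //; split=> [eqE|].
  have [|j [wj [/invr_inj xj xeq]]] := eq1; first by rewrite eqE.
  by exists j; do 2!split=> //; move=> l k lj kj; apply/invr_inj/xeq.
move=> [j [wj [xj xeq]]]; apply/esym/oppr_inj/eq2.
exists j; do 2!split=> //; first by rewrite xj.
by move=> l k lj kj; congr (_^-1); apply: xeq.
Qed.

(** * The three weighted means and the least weight *)

Lemma weighted_arithmetic_mean_gt0 (R : realType) (n : nat)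
    (w x : 'I_n -> R) :
  (forall i, 0 < w i) -> (forall i, 0 < x i) -> \sum_(i < n) w i = 1 ->
  0 < weighted_arithmetic_mean w x.
Proof.
move=> w_gt0 x_gt0 w1; rewrite lt_neqAle eq_sym sumr_ge0 ?andbT; last first.
  by move=> i _; rewrite mulr_ge0 ?ltW.
apply/eqP => wx0; have : \sum_(i < n) w i = 0.
  apply: big1 => i _.
  have wx_ge0 (k : 'I_n) (_ : true) : 0 <= w k * x k by rewrite mulr_ge0 ?ltW.
  have /(_ i isT)/eqP := psumr_eq0P wx_ge0 wx0.
  by rewrite gt_eqF ?mulr_gt0.
by apply/eqP; rewrite w1 oner_eq0.
Qed.

Lemma weighted_harmonic_mean_gt0 (R : realType) (n : nat) (w x : 'I_n -> R) :
  (forall i, 0 < w i) -> (forall i, 0 < x i) -> \sum_(i < n) w i = 1 ->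
  0 < weighted_harmonic_mean w x.
Proof.
move=> w_gt0 x_gt0 w1; rewrite invr_gt0.
by apply: (weighted_arithmetic_mean_gt0 w_gt0) => // i; rewrite invr_gt0.
Qed.

(** The average of (x - a)^2 / x, which is positive since some x_i differs
    from a, equals a * (a - h) / h. *)
Lemma weighted_harmonic_lt_arithmetic (R : realType) (n : nat)
    (w x : 'I_n -> R) :
  (forall i, 0 < w i) -> (forall i, 0 < x i) -> \sum_(i < n) w i = 1 ->
  ~ (forall i j, x i = x j) ->
  weighted_harmonic_mean w x < weighted_arithmetic_mean w x.
Proof.
move=> w_gt0 x_gt0 w1 xneq.
have a_gt0 := weighted_arithmetic_mean_gt0 w_gt0 x_gt0 w1.
have h_gt0 := weighted_harmonic_mean_gt0 w_gt0 x_gt0 w1.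
set a := weighted_arithmetic_mean w x in a_gt0 *.
set h := weighted_harmonic_mean w x in h_gt0 *.
have gapE i : - 2 * a + 1 * x i + a ^+ 2 / x i = (x i - a) ^+ 2 / x i.
  by field; rewrite gt_eqF.
have gap_ge0 (i : 'I_n) (_ : true) :
    0 <= w i * (- 2 * a + 1 * x i + a ^+ 2 / x i).
  by rewrite gapE mulr_ge0 ?divr_ge0 ?sqr_ge0 ?ltW.
have sumE : \sum_(i < n) w i * (- 2 * a + 1 * x i + a ^+ 2 / x i) =
    a * (a - h) / h.
  rewrite sum_affine_inv// -/(weighted_arithmetic_mean w x) -/a.
  rewrite -[\sum_(i < n) w i / x i]invrK -/(weighted_harmonic_mean w x) -/h.
  by field; rewrite gt_eqF.
clearbody h; suff : 0 < a * (a - h) / h.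
  by rewrite -mulrA pmulr_rgt0// pmulr_lgt0 ?invr_gt0// subr_gt0.
rewrite -sumE lt_neqAle sumr_ge0 ?andbT//; apply/negP => /eqP/esym sum0.
apply: xneq => i j; suff xa k : x k = a by rewrite !xa.
have /(_ k isT)/eqP := psumr_eq0P gap_ge0 sum0.
rewrite gapE mulf_eq0 (gt_eqF (w_gt0 k))/= mulf_eq0 invr_eq0.
by rewrite (gt_eqF (x_gt0 k)) orbF sqrf_eq0 subr_eq0 => /eqP.
Qed.

Lemma weighted_geometric_meanE (R : realType) (n : nat) (w x : 'I_n -> R) :
  (forall i, 0 < x i) ->
  weighted_geometric_mean w x = expR (\sum_(i < n) w i * ln (x i)).
Proof.
move=> x_gt0; rewrite expR_sum; apply: eq_bigr => i _.
by rewrite /powR gt_eqF.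
Qed.

Lemma min_weight_le (R : realType) (n : nat) (w : 'I_n -> R) (i : 'I_n) :
  min_weight w <= w i.
Proof. exact: bigmin_le. Qed.

Lemma min_weight_gt0 (R : realType) (n : nat) (w : 'I_n -> R) :
  (forall i, 0 < w i) -> 0 < min_weight w.
Proof. by move=> w_gt0; apply/bigmin_gtP. Qed.

Lemma min_weight_le_half (R : realType) (n : nat) (w x : 'I_n -> R) :
  (forall i, 0 < w i) -> \sum_(i < n) w i = 1 -> ~ (forall i j, x i = x j) ->
  2 * min_weight w <= 1.
Proof.
move=> w_gt0 w1 xneq; have [i [j ij]] : exists i j : 'I_n, i != j.
  apply: contrapT => eqI; apply: xneq => i j; congr x; apply/eqP.
  by apply: contrapT => /negP ij; apply: eqI; exists i, j.
rewrite -[leRHS]w1 (bigD1 i)//= (bigD1 j) 1?eq_sym//=.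
have rest_ge0 : 0 <= \sum_(k < n | (k != i) && (k != j)) w k.
  by apply: sumr_ge0 => k _; exact: ltW.
by have := min_weight_le w i; have := min_weight_le w j; lra.
Qed.

(** * The equation for the two-point parameter *)

(** The equation for xi after clearing its denominator, which is positive for
    xi >= 0 and m <= 1 / 2. *)
Definition two_value_quadratic (R : realType) (a h m xi : R) : R :=
  a * m * xi ^+ 2 - (a - h * (1 - 2 * m)) * xi + h * m.

Lemma two_value_harmonic_eq (R : realType) (a h m xi : R) :
  0 < m -> 2 * m <= 1 -> 0 <= xi ->
  h = two_value_harmonic a m xi <-> two_value_quadratic a h m xi = 0.
Proof.
move=> m_gt0 m_le xi_ge0.
have d_gt0 : 0 < m - 2 * m * xi + xi.
  have : 0 <= (1 - 2 * m) * xi by rewrite mulr_ge0// subr_ge0.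
  by lra.
have -> : two_value_quadratic a h m xi =
    (h - two_value_harmonic a m xi) * (m - 2 * m * xi + xi).
  by rewrite /two_value_quadratic /two_value_harmonic; field; rewrite gt_eqF.
split=> [<-|/eqP]; first by rewrite subrr mul0r.
by rewrite mulf_eq0 (gt_eqF d_gt0) orbF subr_eq0 => /eqP.
Qed.

Lemma two_value_quadratic_ivt (R : realType) (a h m lo hi : R) : lo <= hi ->
  let q := two_value_quadratic a h m in
  q lo <= 0 <= q hi \/ q hi <= 0 <= q lo ->
  exists2 xi, lo <= xi <= hi & q xi = 0.
Proof.
move=> lohi q.
pose p := (a * m) *: 'X^2 - (a - h * (1 - 2 * m)) *: 'X + (h * m)%:P.
have pE t : p.[t] = q t by rewrite /p /q /two_value_quadratic !hornerE.
case=> [sgn|/andP[hi_le lo_ge]].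
- have [|xi xiI /rootP xi0] := @poly_ivt R p lo hi lohi; first by rewrite !pE.
  by exists xi; rewrite -?pE.
- have [|xi xiI /rootP/eqP] := @poly_ivt R (- p) lo hi lohi.
    by rewrite !hornerN !pE oppr_le0 oppr_ge0 lo_ge.
  by rewrite hornerN oppr_eq0 pE => /eqP; exists xi.
Qed.

(** Two distinct roots would factor the quadratic, giving its value at 1 the
    sign of (1 - xi) * (1 - xi'), whereas that value is negative. *)
Lemma two_value_quadratic_same_side (R : realType) (a h m xi xi' : R) :
  0 < a -> 0 < m -> m < 1 -> h < a ->
  two_value_quadratic a h m xi = 0 -> two_value_quadratic a h m xi' = 0 ->
  0 <= (1 - xi) * (1 - xi') -> xi = xi'.
Proof.
move=> a_gt0 m_gt0 m_lt1 ha q0 q0' side; apply/eqP/contraT => neq.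
have vieta : a - h * (1 - 2 * m) = a * m * (xi + xi').
  apply: (@mulfI _ (xi - xi')); first by rewrite subr_eq0.
  apply/eqP; rewrite -subr_eq0 -[0](subrr 0) -{1}q0' -q0.
  by rewrite /two_value_quadratic; apply/eqP; ring.
have vieta' : h * m = a * m * (xi * xi').
  by move: q0; rewrite /two_value_quadratic vieta => q0; lra.
have q1 : - ((1 - m) * (a - h)) = a * m * ((1 - xi) * (1 - xi')).
  have -> : - ((1 - m) * (a - h)) = a * m - (a - h * (1 - 2 * m)) + h * m.
    by ring.
  by rewrite vieta vieta'; ring.
have : 0 <= - ((1 - m) * (a - h)).
  by rewrite q1; apply: mulr_ge0 side; rewrite mulr_ge0 ?ltW.
by rewrite oppr_ge0 leNgt mulr_gt0// subr_gt0.
Qed.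

Lemma two_value_harmonic_exists_unique (R : realType) (a h m : R) :
  0 < m -> 2 * m <= 1 -> 0 < h -> h < a ->
  (exists! xi : R, 0 <= xi <= 1 /\ h = two_value_harmonic a m xi) /\
  (exists! xi : R, 1 <= xi <= 1 / m /\ h = two_value_harmonic a m xi).
Proof.
move=> m_gt0 m_le h_gt0 ha; have a_gt0 := lt_trans h_gt0 ha.
have m_lt1 : m < 1 by lra.
have Vm_ge1 : 1 <= 1 / m by rewrite ler_pdivlMr// mul1r ltW.
have q0 : 0 <= two_value_quadratic a h m 0.
  have := mulr_ge0 (ltW h_gt0) (ltW m_gt0).
  by rewrite /two_value_quadratic; lra.
have q1 : two_value_quadratic a h m 1 <= 0.
  have -> : two_value_quadratic a h m 1 = - ((1 - m) * (a - h)).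
    by rewrite /two_value_quadratic; ring.
  by rewrite oppr_le0 mulr_ge0 ?subr_ge0 ?ltW.
have qVm : 0 <= two_value_quadratic a h m (1 / m).
  have -> : two_value_quadratic a h m (1 / m) = h * (1 - m) ^+ 2 / m.
    by rewrite /two_value_quadratic; field; rewrite gt_eqF.
  by rewrite divr_ge0 ?(ltW m_gt0)// mulr_ge0 ?sqr_ge0// ltW.
split.
- have [|xi xiI qxi] := @two_value_quadratic_ivt R a h m 0 1 ler01.
    by right; rewrite q1.
  exists xi; split=> [|xi' [xiI' /two_value_harmonic_eq qxi']].
    by split=> //; apply/two_value_harmonic_eq => //; lra.
  apply: (two_value_quadratic_same_side a_gt0 m_gt0 m_lt1 ha qxi).
    by apply: qxi' => //; lra.
  by rewrite mulr_ge0 ?subr_ge0//; lra.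
- have [|xi xiI qxi] := @two_value_quadratic_ivt R a h m 1 (1 / m) Vm_ge1.
    by left; rewrite q1.
  exists xi; split=> [|xi' [xiI' /two_value_harmonic_eq qxi']].
    by split=> //; apply/two_value_harmonic_eq => //; lra.
  apply: (two_value_quadratic_same_side a_gt0 m_gt0 m_lt1 ha qxi).
    by apply: qxi' => //; lra.
  by rewrite mulr_le0 ?subr_le0//; lra.
Qed.

(** The dictionary between xi and the two-point law: positive points, matching
    mean and mean reciprocal, and the geometric mean as an exponential.  The
    end points xi = 0 and xi = 1 / m are excluded by h > 0. *)
Lemma two_value_config (R : realType) (a h m xi : R) :
  0 < a -> 0 < m -> 2 * m <= 1 -> 0 < h -> 0 <= xi <= 1 / m ->
  h = two_value_harmonic a m xi ->
  let u := a * xi in let v := a * ((1 - m * xi) / (1 - m)) in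
  [/\ 0 < u, 0 < v, a = m * u + (1 - m) * v, h^-1 = m / u + (1 - m) / v &
      two_value_geometric a m xi = expR (m * ln u + (1 - m) * ln v)].
Proof.
move=> a_gt0 m_gt0 m_le h_gt0 /andP[xi_ge0 xi_le] hE u v.
have m1_gt0 : 0 < 1 - m by lra.
have xi_neq0 : xi != 0.
  apply/eqP => xi0; move: h_gt0.
  by rewrite hE /two_value_harmonic xi0 !mul0r mulr0 ltxx.
have xi_gt0 : 0 < xi by rewrite lt_neqAle eq_sym xi_neq0.
have mxi_neq0 : 1 - m * xi != 0.
  apply/eqP => mxi; move: h_gt0.
  by rewrite hE /two_value_harmonic mxi mulr0 mul0r mulr0 ltxx.
have mxi_gt0 : 0 < 1 - m * xi.
  rewrite lt_neqAle eq_sym mxi_neq0 subr_ge0 mulrC.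
  by rewrite -ler_pdivlMr.
have d_gt0 : 0 < m - 2 * m * xi + xi.
  have : 0 <= (1 - 2 * m) * xi by rewrite mulr_ge0// subr_ge0.
  by lra.
have r_gt0 : 0 < (1 - m * xi) / (1 - m) by rewrite divr_gt0.
have u_gt0 : 0 < u by rewrite mulr_gt0.
have v_gt0 : 0 < v by rewrite mulr_gt0.
split=> //.
- by rewrite /u /v; field; rewrite gt_eqF.
- rewrite hE /two_value_harmonic /u /v; field.
  by rewrite !gt_eqF.
- rewrite /two_value_geometric /powR (gt_eqF xi_gt0) (gt_eqF r_gt0).
  rewrite -{1}[a]lnK ?posrE// -!expRD; congr expR.
  rewrite /u /v [ln (a * xi)]lnM ?posrE// [ln (a * _)]lnM ?posrE//; ring.
Qed.

(** * The sharp bounds on the geometric mean *)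

Theorem theorem1p2 (R : realType) (n : nat) (alpha x : 'I_n -> R)
  (alpha_gt0 : forall i, 0 < alpha i)
  (x_gt0 : forall i, 0 < x i)
  (alpha_sum1 : \sum_(i < n) alpha i = 1)
  (x_not_all_equal : ~ (forall i j, x i = x j)) :
  let h := weighted_harmonic_mean alpha x in
  let g := weighted_geometric_mean alpha x in
  let a := weighted_arithmetic_mean alpha x in
  let m := min_weight alpha in
  (exists! xi : R, 0 <= xi <= 1 /\ h = two_value_harmonic a m xi) /\
  (exists! xi : R, 1 <= xi <= 1 / m /\ h = two_value_harmonic a m xi) /\
  (forall xi0 xi1 : R,
     0 <= xi0 <= 1 -> h = two_value_harmonic a m xi0 ->
     1 <= xi1 <= 1 / m -> h = two_value_harmonic a m xi1 ->
     two_value_geometric a m xi1 <= g /\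
     g <= two_value_geometric a m xi0 /\
     (two_value_geometric a m xi1 = g <->
        exists j : 'I_n, alpha j = m /\ x j = a * xi1 /\
          forall l k : 'I_n, l <> j -> k <> j -> x l = x k) /\
     (g = two_value_geometric a m xi0 <->
        exists j : 'I_n, alpha j = m /\ x j = a * xi0 /\
          forall l k : 'I_n, l <> j -> k <> j -> x l = x k)).
Proof.
move=> h g a m.
have a_gt0 : 0 < a by exact: weighted_arithmetic_mean_gt0.
have h_gt0 : 0 < h by exact: weighted_harmonic_mean_gt0.
have ha : h < a by exact: weighted_harmonic_lt_arithmetic.
have m_gt0 : 0 < m by exact: min_weight_gt0.
have m_le i : m <= alpha i by exact: min_weight_le.
have m_half : 2 * m <= 1.
  exact: min_weight_le_half alpha_gt0 alpha_sum1 x_not_all_equal.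
have m1_gt0 : 0 < 1 - m by lra.
have gE : g = expR (\sum_(i < n) alpha i * ln (x i)).
  exact: weighted_geometric_meanE.
have hV : h^-1 = \sum_(i < n) alpha i / x i by rewrite /h invrK.
have [ex0 ex1] := two_value_harmonic_exists_unique m_gt0 m_half h_gt0 ha.
do 2!split=> //; move=> xi0 xi1 xi0I h0 xi1I h1.
(* xi = 1 would make the two-point law degenerate and give h = a. *)
have harm1 : two_value_harmonic a m 1 = a.
  by rewrite /two_value_harmonic; field; apply/negP => /eqP; lra.
have xi_neq1 xi : h = two_value_harmonic a m xi -> xi != 1.
  by move=> hE; apply/eqP => xi1E; move: ha; rewrite hE xi1E harm1 ltxx.
(* v - u has the sign of 1 - xi: u is the smaller point for xi0 and the
   larger one for xi1. *)
have vB xi : a * ((1 - m * xi) / (1 - m)) - a * xi = a * (1 - xi) / (1 - m).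
  by field; rewrite gt_eqF.
have Vm_ge1 : 1 <= 1 / m by rewrite ler_pdivlMr// mul1r; lra.
have [|u0_gt0 v0_gt0 a0 hV0 ->] := two_value_config a_gt0 m_gt0 m_half h_gt0 _ h0.
  by lra.
have [|u1_gt0 v1_gt0 a1 hV1 ->] := two_value_config a_gt0 m_gt0 m_half h_gt0 _ h1.
  by lra.
have uv0 : a * xi0 < a * ((1 - m * xi0) / (1 - m)).
  rewrite -subr_gt0 vB divr_gt0// mulr_gt0// subr_gt0 lt_neqAle.
  by rewrite xi_neq1//; case/andP: xi0I.
have vu1 : a * ((1 - m * xi1) / (1 - m)) < a * xi1.
  rewrite -subr_lt0 vB -mulrA pmulr_rlt0// nmulr_rlt0 ?invr_gt0//.
  by rewrite subr_lt0 lt_neqAle eq_sym xi_neq1//; case/andP: xi1I.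
rewrite gE !ler_expR.
have [le0 eq0] := weighted_ln_le_two_point m_gt0 m_le x_gt0 u0_gt0 uv0
  alpha_sum1 a0 (etrans (esym hV) hV0).
have [le1 eq1] := weighted_ln_ge_two_point m_gt0 m_le x_gt0 v1_gt0 vu1
  alpha_sum1 a1 (etrans (esym hV) hV1).
split=> //; split=> //; split.
- by rewrite -eq1; split=> [/expR_inj|->].
- by rewrite -eq0; split=> [/expR_inj|->].
Qed.
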